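(* Let $E$ be a truncated normed Riesz space with norm $\|\cdot\|$ and suppose that $E\oplus\mathbb{R}$ is equipped with any unitization norm $\|\cdot\|_u$. Then $(E,\|\cdot\|)$ is a Banach lattice if and only if $(E\oplus\mathbb{R},\|\cdot\|_u)$ is a Banach lattice.
   Context: All Riesz spaces are real. A truncated Riesz space is a nonzero Riesz space $E$ together with a truncation, i.e. a nonzero map $x\mapsto x^{*}$ from the positive cone $E^{+}$ into itself such that $x\wedge y^{*}\leq x^{*}\leq x$ for all $x,y\in E^{+}$. Unitization: the vector space direct sum $E\oplus\mathbb{R}$ (elements written $x+\alpha$ with $x\in E$, $\alpha\in\mathbb{R}$; $1$ denotes $0+1$; $x\in E$ is identified with $x+0$) is a Riesz space whose absolute value is given by $|x+0|=|x|$ and, for $\alpha\neq 0$, $|x+\alpha|=|x|-2|\alpha|\left(\tfrac{1}{\alpha}x^{-}\vee\tfrac{-1}{\alpha}x^{+}\right)^{*}+|\alpha|$. Equivalently, $x+\alpha\geq 0$ if and only if either $\alpha=0$ and $x\geq 0$, or $\alpha>0$ and $\left(\tfrac1\alpha x^{-}\right)^{*}=\tfrac1\alpha x^{-}$. For this structure (known from earlier work) $E$ is a Riesz subspace of $E\oplus\mathbb{R}$ and $x^{*}=1\wedge x$ for all $x\in E^{+}$. A lattice norm on a Riesz space is a norm such that $|u|\leq|v|$ implies $\|u\|\leq\|v\|$. A truncated normed Riesz space is a truncated Riesz space $E$ with a lattice norm $\|\cdot\|$ for which the truncation is norm-bounded; as a standing normalization, $\sup\{\|x^{*}\|:x\in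 E^{+}\}=1$. A unitization norm on $E\oplus\mathbb{R}$ is a lattice norm $\|\cdot\|_u$ on $E\oplus\mathbb{R}$ extending $\|\cdot\|$ (i.e. $\|x\|_u=\|x\|$ for $x\in E$) with $\|1\|_u=1$. A Banach lattice is a Riesz space with a complete lattice norm. *)

(* Defs.v *)
From HB Require Import structures.
From mathcomp Require Import all_boot all_order all_algebra.
From mathcomp Require Import all_classical all_reals all_analysis.

Set Implicit Arguments.
Unset Strict Implicit.
Unset Printing Implicit Defensive.

Import Order.TTheory GRing.Theory Num.Theory.
Import numFieldNormedType.Exports.

Local Open Scope classical_set_scope.
Local Open Scope ring_scope.

(* Hierarchy-Builder cannot place a join of [GRing.Lmodule] and
   [Order.Lattice ring_display] under the existing [Num.RealDomain], so the
   lattice operations are fields here (with the axioms of the factory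
   [Order.POrder_MeetJoin_isLattice]); the instance after the structure makes
   every [rieszType] a [latticeType]. *)
HB.mixin Record isRiesz (R : realType) E
    of Num.POrderedZmodule E & GRing.Lmodule R E := {
  riesz_leD2r : forall z x y : E, x <= y -> x + z <= y + z ;
  riesz_scaler_ge0 : forall (a : R) (x : E), 0 <= a -> 0 <= x -> 0 <= a *: x ;
  riesz_meet : E -> E -> E ;
  riesz_join : E -> E -> E ;
  riesz_meetP : forall x y z : E,
    (x <= riesz_meet y z) = (x <= y) && (x <= z) ;
  riesz_joinP : forall x y z : E,
    (riesz_join x y <= z) = (x <= z) && (y <= z)
}.

#[short(type="rieszType")]
HB.structure Definition Riesz (R : realType) :=
  {E of Num.POrderedZmodule E & GRing.Lmodule R E & isRiesz R E}.

HB.instance Definition _ (R : realType) (E : rieszType R) :=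
  Order.POrder_MeetJoin_isLattice.Build ring_display (Riesz.sort E)
    (@riesz_meetP R E) (@riesz_joinP R E).

Section riesz_ops.
Context {R : realType} {E : rieszType R}.
Implicit Types x : E.

Definition rpos x : E := (x `|` 0)%O.
Definition rneg x : E := (- x `|` 0)%O.
Definition rabs x : E := (x `|` - x)%O.

End riesz_ops.

Section riesz_theory.
Context {R : realType} {E : rieszType R}.
Implicit Types (x y z : E) (a b : R).

Lemma rleD2r z x y : (x + z <= y + z) = (x <= y).
Proof.
apply/idP/idP; last exact: riesz_leD2r.
by move=> /(riesz_leD2r (- z)); rewrite !addrK.
Qed.

Lemma rleD2l z x y : (z + x <= z + y) = (x <= y).
Proof. by rewrite ![z + _]addrC rleD2r. Qed.

Lemma rleD x y z t : x <= y -> z <= t -> x + z <= y + t.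
Proof.
by move=> xy zt; apply: (@le_trans _ _ (y + z)); rewrite ?rleD2r ?rleD2l.
Qed.

Lemma rsubr_ge0 x y : (0 <= y - x) = (x <= y).
Proof. by rewrite -[LHS](rleD2r x) add0r subrK. Qed.

Lemma rleBlDr x y z : (x - y <= z) = (x <= z + y).
Proof. by rewrite -[LHS](rleD2r y) subrK. Qed.

Lemma rleBlDl x y z : (x - y <= z) = (x <= y + z).
Proof. by rewrite rleBlDr addrC. Qed.

Lemma rleBrDr x y z : (x <= y - z) = (x + z <= y).
Proof. by rewrite -[LHS](rleD2r z) subrK. Qed.

Lemma rleBrDl x y z : (x <= y - z) = (z + x <= y).
Proof. by rewrite rleBrDr addrC. Qed.

Lemma rleN2 x y : (- x <= - y) = (y <= x).
Proof. by rewrite -[LHS]rsubr_ge0 opprK addrC rsubr_ge0. Qed.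

Lemma roppr_le0 x : (- x <= 0) = (0 <= x).
Proof. by rewrite -[in LHS]oppr0 rleN2. Qed.

Lemma roppr_ge0 x : (0 <= - x) = (x <= 0).
Proof. by rewrite -[in LHS]oppr0 rleN2. Qed.

Lemma raddr_ge0 x y : 0 <= x -> 0 <= y -> 0 <= x + y.
Proof. by move=> x0 y0; rewrite -[0]addr0 rleD. Qed.

Lemma rlerZl a x y : 0 <= a -> x <= y -> a *: x <= a *: y.
Proof.
by move=> a0 xy; rewrite -rsubr_ge0 -scalerBr riesz_scaler_ge0// rsubr_ge0.
Qed.

Lemma rlerZVl a x y : 0 < a -> (a^-1 *: x <= y) = (x <= a *: y).
Proof.
move=> a0; apply/idP/idP => [/(rlerZl (ltW a0))|].
  by rewrite scalerA divff ?gt_eqF// scale1r.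
have a1 : 0 <= a^-1 by rewrite invr_ge0 ltW.
by move=> /(rlerZl a1); rewrite scalerA mulVf ?gt_eqF// scale1r.
Qed.

Lemma rlerZVr a x y : 0 < a -> (x <= a^-1 *: y) = (a *: x <= y).
Proof. by move=> a0; rewrite -{2}(invrK a) rlerZVl// invr_gt0. Qed.

Lemma rjoinDr x y z : ((x `|` y) + z = (x + z) `|` (y + z))%O.
Proof.
apply/le_anti/andP; split.
  by rewrite -rleBrDr leUx !rleBrDr leUl leUr.
by rewrite leUx !rleD2r leUl leUr.
Qed.

Lemma rpos_ge0 x : 0 <= rpos x. Proof. exact: leUr. Qed.
Lemma rneg_ge0 x : 0 <= rneg x. Proof. exact: leUr. Qed.
Lemma rpos_ge x : x <= rpos x. Proof. exact: leUl. Qed.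
Lemma rneg_ge x : - x <= rneg x. Proof. exact: leUl. Qed.

Lemma rnegN x : rneg (- x) = rpos x.
Proof. by rewrite /rneg opprK. Qed.

Lemma rposN x : rpos (- x) = rneg x.
Proof. by []. Qed.

Lemma rposBx x : rpos x - x = rneg x.
Proof. by rewrite rjoinDr subrr add0r joinC. Qed.

Lemma rposBneg x : rpos x - rneg x = x.
Proof. by rewrite -rposBx opprB addrC subrK. Qed.

Lemma rabs_ge0 x : 0 <= rabs x.
Proof.
have h : 0 <= rabs x + rabs x by rewrite -[0](subrr x) rleD// ?leUl ?leUr.
have h2 : 0 <= 2^-1 :> R by rewrite invr_ge0.
have := rlerZl h2 h; rewrite scaler0 -mulr2n -[rabs x *+ 2]scaler_nat scalerA.
by rewrite mulVf ?pnatr_eq0// scale1r.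
Qed.

Lemma rabsE x : rabs x = rpos x + rneg x.
Proof.
apply/le_anti/andP; split.
  rewrite leUx -{1}[x]addr0 rleD ?rpos_ge ?rneg_ge0//=.
  by rewrite -[leLHS]add0r rleD ?rneg_ge ?rpos_ge0.
rewrite -rposBx addrA -mulr2n -scaler_nat rleBlDr -rlerZVr ?ltr0n// leUx.
rewrite !rlerZVr ?ltr0n// scaler0 scaler_nat mulr2n rleD2r leUl /=.
by rewrite -rleBlDr sub0r leUr.
Qed.

Lemma rabsN x : rabs (- x) = rabs x.
Proof. by rewrite /rabs opprK joinC. Qed.

End riesz_theory.

(* The truncation is a total function; only its values on the positive cone
   are constrained, and only those are used below. The last field also makes
   [E] nonzero. *)
Record truncation (R : realType) (E : rieszType R) := Truncation {
  trunc :> E -> E ;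
  trunc_ge0 : forall x : E, 0 <= x -> 0 <= trunc x ;
  trunc_meet : forall x y : E, 0 <= x -> 0 <= y -> (x `&` trunc y <= trunc x)%O ;
  trunc_le : forall x : E, 0 <= x -> trunc x <= x ;
  trunc_neq0 : exists2 x : E, 0 <= x & trunc x != 0
}.

Section truncation_theory.
Context {R : realType} {E : rieszType R} (T : truncation E).
Implicit Types (x y p q : E) (a b : R).

Lemma trunc0 : T 0 = 0.
Proof. by apply/le_anti/andP; split; [exact: trunc_le|exact: trunc_ge0]. Qed.

Lemma truncK x : 0 <= x -> T (T x) = T x.
Proof.
move=> x0; have Tx0 := trunc_ge0 T x0.
apply/le_anti/andP; split; first exact: trunc_le.
by rewrite -{1}[T x]meetxx trunc_meet.
Qed.

Lemma le_trunc x y : 0 <= x -> x <= y -> T x <= T y.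
Proof.
move=> x0 xy; have y0 := le_trans x0 xy.
have /le_trans : T x <= (y `&` T x)%O.
  by rewrite lexI lexx (le_trans (trunc_le T x0) xy).
by apply; exact: trunc_meet.
Qed.

Definition tfix p := (0 <= p) && (T p == p).

Lemma tfix0 : tfix 0. Proof. by rewrite /tfix lexx trunc0 eqxx. Qed.

Lemma tfix_trunc x : 0 <= x -> tfix (T x).
Proof. by move=> x0; rewrite /tfix trunc_ge0// truncK// eqxx. Qed.

Lemma tfix_le x p : 0 <= x -> x <= p -> tfix p -> tfix x.
Proof.
move=> x0 xp /andP[p0 /eqP pT]; rewrite /tfix x0 /= eq_le trunc_le//=.
have /le_trans : x <= (x `&` T p)%O by rewrite lexI lexx pT.
by apply; exact: trunc_meet.
Qed.

Lemma tfixU p q : tfix p -> tfix q -> tfix (p `|` q)%O.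
Proof.
move=> /andP[p0 /eqP pT] /andP[q0 /eqP qT].
have pq0 : 0 <= (p `|` q)%O by rewrite lexU2// p0.
rewrite /tfix pq0 /= eq_le trunc_le//= leUx -{1}pT -{2}qT.
by rewrite !le_trunc// ?leUl ?leUr.
Qed.

Lemma le_tfix_trunc a x p z : 0 <= a -> 0 <= x -> tfix p ->
  z <= a *: p -> z <= x -> z <= a *: T (a^-1 *: x).
Proof.
rewrite le_eqVlt => /predU1P[<-|a0] x0 /andP[p0 /eqP pT].
  by rewrite !scale0r.
move=> zp zx; rewrite -rlerZVl//.
have ax0 : 0 <= a^-1 *: x by rewrite riesz_scaler_ge0 ?invr_ge0 ?(ltW a0).
apply: le_trans (trunc_meet T ax0 p0).
by rewrite pT lexI !rlerZVl// zp scalerA divff ?gt_eqF// scale1r zx.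
Qed.

End truncation_theory.

(* The pair [(x, a)] stands for [x + a]. *)
Definition unitization (R : realType) (E : rieszType R) (T : truncation E)
  : Type := (E * R^o)%type.

Section unitization.
Context {R : realType} {E : rieszType R} {T : truncation E}.
Local Notation U := (unitization T).
Implicit Types (u v w : U) (x y p q : E) (a b : R).

HB.instance Definition _ := GRing.Lmodule.copy U (E * R^o)%type.

Definition uembed x : U := (x, 0).
Definition uone : U := (0, 1).

(* The positive cone of [E + R]; the associated absolute value is computed in
   [uembed_abs] and [unitization_abs]. *)
Definition ucone u : bool :=
  if u.2 == 0 :> R then 0 <= u.1
  else (0 < (u.2 : R)) && (T (u.2^-1 *: rneg u.1) == u.2^-1 *: rneg u.1).

Definition ule u v : bool := ucone (v - u).

Lemma uconeP u : reflect
  (0 <= (u.2 : R) /\ exists2 p, tfix T p & - u.1 <= u.2 *: p) (ucone u).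
Proof.
case: u => x a; rewrite /ucone /=; apply: (iffP idP).
  case: eqP => [-> x0|_ /andP[a0 /eqP xT]].
    by split => //; exists 0; rewrite ?tfix0// scaler0 roppr_le0.
  have ax0 : 0 <= a^-1 *: rneg x.
    by rewrite riesz_scaler_ge0 ?rneg_ge0 ?invr_ge0 ?(ltW a0).
  split; first exact: ltW.
  exists (a^-1 *: rneg x); first by rewrite /tfix ax0 xT eqxx.
  by rewrite scalerA divff ?gt_eqF// scale1r rneg_ge.
move=> [a0 [p pT xp]]; case: eqP => [az|/eqP an0].
  by move: xp; rewrite az scale0r roppr_le0.
have {an0}a0 : 0 < a by rewrite lt_def an0.
rewrite a0 /=.
have ax0 : 0 <= a^-1 *: rneg x.
  by rewrite riesz_scaler_ge0 ?rneg_ge0 ?invr_ge0 ?(ltW a0).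
have : tfix T (a^-1 *: rneg x); last by case/andP.
have p0 : 0 <= p by case/andP: pT.
apply: tfix_le pT => //; rewrite rlerZVl// leUx xp /=.
by rewrite riesz_scaler_ge0 ?(ltW a0).
Qed.

Lemma ucone0 : ucone 0.
Proof. by rewrite /ucone eqxx /= lexx. Qed.

Lemma uconeD u v : ucone u -> ucone v -> ucone (u + v).
Proof.
move=> /uconeP[u0 [p pT up]] /uconeP[v0 [q qT vq]]; apply/uconeP.
split; first exact: addr_ge0.
exists (p `|` q)%O; first exact: tfixU.
rewrite /= opprD scalerDl rleD//.
  by rewrite (le_trans up)// rlerZl// leUl.
by rewrite (le_trans vq)// rlerZl// leUr.
Qed.

Lemma uconeZ a u : 0 <= a -> ucone u -> ucone (a *: u).
Proof.
move=> a0 /uconeP[u0 [p pT up]]; apply/uconeP; split; first exact: mulr_ge0.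
by exists p => //=; rewrite -scalerN -scalerA rlerZl.
Qed.

Lemma ucone_anti u : ucone u -> ucone (- u) -> u = 0.
Proof.
case: u => x a /uconeP[/= a0 [p pT up]] /uconeP[/= a0' [q qT uq]].
have az : a = 0 by apply/le_anti; rewrite a0 -oppr_ge0 a0'.
move: up uq; rewrite az oppr0 !scale0r roppr_le0 opprK => x0 x0'.
by congr pair; apply/le_anti; rewrite x0 x0'.
Qed.

Lemma ule_refl : reflexive ule.
Proof. by move=> u; rewrite /ule subrr ucone0. Qed.

Lemma ule_anti : antisymmetric ule.
Proof.
move=> u v /andP[uv vu]; apply/esym/subr0_eq/ucone_anti => //.
by rewrite opprB.
Qed.

Lemma ule_trans : transitive ule.
Proof.
move=> v u w uv vw; rewrite /ule -(subrK v w) -addrA.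
exact: uconeD.
Qed.

HB.instance Definition _ :=
  Order.Le_isPOrder.Build ring_display U ule_refl ule_anti ule_trans.

Lemma uleE u v : (u <= v) = ucone (v - u).
Proof. by []. Qed.

Definition upos_nneg u : U :=
  (rpos u.1 - u.2 *: T (u.2^-1 *: rneg u.1), u.2).

Definition upos u : U :=
  if 0 <= (u.2 : R) then upos_nneg u else upos_nneg (- u) + u.

Lemma upos_nnegP u : 0 <= (u.2 : R) ->
  [/\ 0 <= upos_nneg u, u <= upos_nneg u &
      forall w, 0 <= w -> u <= w -> upos_nneg u <= w].
Proof.
case: u => x a /= a0.
have ax0 : 0 <= a^-1 *: rneg x by rewrite riesz_scaler_ge0 ?rneg_ge0 ?invr_ge0.
have sT := tfix_trunc T ax0.
have sx : a *: T (a^-1 *: rneg x) <= rneg x.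
  move: a0; rewrite le_eqVlt => /predU1P[<-|a0].
    by rewrite scale0r rneg_ge0.
  by rewrite -rlerZVr// trunc_le.
split.
- rewrite uleE subr0; apply/uconeP; split => //=.
  exists (T (a^-1 *: rneg x)) => //.
  by rewrite opprB -[leRHS]addr0 rleD2l roppr_le0 rpos_ge0.
- rewrite uleE; apply/uconeP; split; rewrite /= ?subrr//.
  exists 0; first exact: tfix0.
  by rewrite scaler0 roppr_le0 addrAC rposBx rsubr_ge0.
- move=> [y b]; rewrite !uleE subr0.
  move=> /uconeP[/= b0 [q qT yq]] /uconeP[/= ab0 [p pT yp]].
  apply/uconeP; split => //=; exists (p `|` q)%O; first exact: tfixU.
  set s := T _ in sT sx *; set r := (p `|` q)%O.
  have as0 : 0 <= a *: s by rewrite riesz_scaler_ge0//; case/andP: sT.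
  have pr : (b - a) *: p <= (b - a) *: r by rewrite rlerZl// leUl.
  have qr : b *: q <= b *: r by rewrite rlerZl// leUr.
  have H : rpos x <= ((b - a) *: r + y) + a *: s.
    rewrite leUx; apply/andP; split.
      rewrite -[leLHS]addr0 rleD// -rleBlDr -opprB.
      exact: le_trans yp pr.
    rewrite -[leLHS](subrr ((b - a) *: r + y)) rleD2l.
    apply: (le_tfix_trunc (p := r)) => //; rewrite ?rneg_ge0 ?tfixU//.
      by rewrite opprD addrC rleBlDr -scalerDl addrC subrK (le_trans yq).
    rewrite opprD addrC rleBlDr -[- y](addKr x) rleD ?rneg_ge//.
    by rewrite -opprB (le_trans yp).
  by rewrite opprB addrAC rleBlDr rleBlDr addrAC.
Qed.


Lemma ule_subr_ge0 u v : (0 <= v - u) = (u <= v).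
Proof. by rewrite !uleE subr0. Qed.

Lemma ule_D2r w u v : u <= v -> u + w <= v + w.
Proof. by rewrite !uleE opprD addrACA subrr addr0. Qed.

Lemma uposP u w : (upos u <= w) = (0 <= w) && (u <= w).
Proof.
have [h0 h1 h2] : [/\ 0 <= upos u, u <= upos u &
    forall w, 0 <= w -> u <= w -> upos u <= w].
  rewrite /upos; case: ifPn => [/upos_nnegP//|]; rewrite -ltNge => u0.
  have /upos_nnegP[h0 h1 h2] : 0 <= ((- u).2 : R) by rewrite oppr_ge0 ltW.
  split.
  - by move: h1; rewrite -ule_subr_ge0 opprK.
  - by rewrite -ule_subr_ge0 addrK.
  - move=> v v0 uv; rewrite -[v](subrK u); apply: ule_D2r.
    apply: h2; rewrite ?ule_subr_ge0//.
    by rewrite -ule_subr_ge0 opprK subrK.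
apply/idP/andP => [uw|[]]; last exact: h2.
by split; [exact: le_trans h0 uw|exact: le_trans h1 uw].
Qed.

Definition ujoin u v : U := v + upos (u - v).
Definition umeet u v : U := u - upos (u - v).

Lemma ujoinP u v w : (ujoin u v <= w) = (u <= w) && (v <= w).
Proof.
rewrite -ule_subr_ge0 opprD addrA ule_subr_ge0 uposP ule_subr_ge0 andbC.
by rewrite -ule_subr_ge0 opprB addrA subrK ule_subr_ge0.
Qed.

Lemma umeetP w u v : (w <= umeet u v) = (w <= u) && (w <= v).
Proof.
rewrite -ule_subr_ge0 addrAC ule_subr_ge0 uposP ule_subr_ge0; congr (_ && _).
by rewrite -ule_subr_ge0 opprB addrCA addrA addrAC addrA subrK ule_subr_ge0.
Qed.

Lemma ule_scaler_ge0 a u : 0 <= a -> 0 <= u -> 0 <= a *: u.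
Proof. by rewrite !uleE !subr0; exact: uconeZ. Qed.

HB.instance Definition _ := isRiesz.Build R U
  ule_D2r ule_scaler_ge0 umeetP ujoinP.

HB.instance Definition _ := Order.Lattice.copy U (Riesz.sort U).

End unitization.

Section unitization_theory.
Context {R : realType} {E : rieszType R} {T : truncation E}.
Local Notation U := (unitization T).
Implicit Types (x : E) (a : R).

Lemma uembed_le x y : (uembed x <= uembed y :> U) = (x <= y).
Proof. by rewrite uleE /ucone /= subrr eqxx rsubr_ge0. Qed.

Lemma rpos_uembed x : rpos (uembed x : U) = uembed (rpos x).
Proof.
apply/le_anti/andP; split.
  by rewrite /rpos leUx !uembed_le leUl leUr.
have [/= h0 h1 h2] := @upos_nnegP R E T (uembed x) (lexx 0).
have -> : uembed (rpos x) = upos_nneg (uembed x : U).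
  by rewrite /upos_nneg /uembed /= scale0r subr0.
by apply: h2; [exact: leUr|exact: leUl].
Qed.

Lemma rpos_unitization (u : U) : rpos u = upos u.
Proof.
apply/le_anti; rewrite uposP /rpos leUr leUl andbT.
have := lexx (upos u); rewrite uposP => /andP[u0 uu].
by rewrite leUx u0 uu.
Qed.

Lemma uembed_abs x : rabs (uembed x : U) = uembed (rabs x).
Proof.
rewrite !rabsE -!rposN rpos_uembed.
have -> : - (uembed x : U) = uembed (- x) by congr pair; rewrite oppr0.
by rewrite rpos_uembed; congr pair; rewrite addr0.
Qed.

Lemma unitization_abs x a : a != 0 ->
  rabs ((x, a) : U) =
  (rabs x - (2 * `|a|) *: T ((a^-1 *: rneg x) `|` (- a^-1 *: rpos x))%O, `|a|).
Proof.
have pos : forall (y : E) (b : R), 0 < b -> rabs ((y, b) : U) =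
  (rabs y - (2 * b) *: T (b^-1 *: rneg y), b).
  move=> y b b0; rewrite rabsE -rposBx addrA -mulr2n rpos_unitization.
  rewrite /upos /= (ltW b0); congr pair; last first.
    by rewrite -[LHS]/(b *+ 2 - b) mulr2n addrK.
  rewrite -[LHS]/((rpos y - b *: T (b^-1 *: rneg y)) *+ 2 - y).
  rewrite mulrnBl addrAC mulr2n rabsE -(rposBx y) addrA; congr (_ - _).
  by rewrite -scaler_nat scalerA.
have le0 : forall (b : R) (y z : E), 0 < b -> 0 <= y -> 0 <= z ->
    (b *: y `|` (- b *: z))%O = b *: y.
  move=> b y z b0 y0 z0; apply/join_idPl.
  apply: (@le_trans _ _ 0); last by rewrite riesz_scaler_ge0 ?(ltW b0).
  by rewrite scaleNr roppr_le0 riesz_scaler_ge0 ?(ltW b0).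
case: (ltgtP a 0) => // [a0|a0] _; last first.
  by rewrite pos// le0 ?invr_gt0 ?rneg_ge0 ?rpos_ge0// gtr0_norm.
have na0 : 0 < - a by rewrite oppr_gt0.
rewrite -rabsN -[- ((x, a) : U)]/((- x, - a) : U) pos// rabsN ltr0_norm//.
have -> : a^-1 = - (- a)^-1 by rewrite invrN opprK.
by rewrite rnegN opprK joinC le0 ?invr_gt0 ?rneg_ge0 ?rpos_ge0.
Qed.

Lemma trunc_meet_uone x : 0 <= x ->
  uembed (T x) = ((uone : U) `&` uembed x)%O.
Proof.
move=> x0; have Tx0 := trunc_ge0 T x0.
apply/le_anti/andP; split.
  rewrite lexI uembed_le trunc_le// andbT uleE; apply/uconeP.
  split; first by rewrite /= subr0 ler01.
  exists (T x); first exact: tfix_trunc.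
  by rewrite /= subr0 sub0r opprK scale1r.
move: (lexx ((uone : U) `&` uembed x)%O); rewrite {1}lexI => /andP[].
move: (_ `&` _)%O => [y b].
move=> /uconeP[/= b1 [p pT yp]] /uconeP[/= b0 [q qT yq]].
apply/uconeP; split => //=; exists (p `|` q)%O; first exact: tfixU.
set r := (p `|` q)%O; rewrite sub0r in b0 yq *; rewrite sub0r in yp.
have pr : (1 - b) *: p <= (1 - b) *: r by rewrite rlerZl// leUl.
have qr : (- b) *: q <= (- b) *: r by rewrite rlerZl// leUr.
have [p0 rT] : 0 <= p /\ tfix T r by split; [case/andP: pT|exact: tfixU].
have zr : y - (- b) *: r <= 1 *: r.
  by rewrite rleBlDr -scalerDl; apply: le_trans pr; rewrite opprK in yp.
have zx : y - (- b) *: r <= x.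
  by rewrite rleBlDr -rleBlDl -opprB; apply: le_trans yq qr.
have := le_tfix_trunc ler01 x0 rT zr zx.
by rewrite invr1 !scale1r opprB !rleBlDr addrC.
Qed.

End unitization_theory.

Record lattice_norm (R : realType) (E : rieszType R) := LatticeNorm {
  lnorm :> E -> R ;
  lnormD : forall x y : E, lnorm (x + y) <= lnorm x + lnorm y ;
  lnormZ : forall (a : R) (x : E), lnorm (a *: x) = `|a| * lnorm x ;
  lnorm0_eq0 : forall x : E, lnorm x = 0 -> x = 0 ;
  lnorm_abs_le : forall x y : E, rabs x <= rabs y -> lnorm x <= lnorm y
}.

Definition normed_by (R : realType) (E : rieszType R) (N : lattice_norm E)
  : Type := E.

Section normed_by.
Context {R : realType} {E : rieszType R} (N : lattice_norm E).

HB.instance Definition _ := GRing.Lmodule.copy (normed_by N) E.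
HB.instance Definition _ := Lmodule_isNormed.Build R (normed_by N)
  (@lnormD R E N) (@lnormZ R E N) (@lnorm0_eq0 R E N).

Lemma normed_byE (x : E) : `|x : normed_by N| = N x.
Proof. by []. Qed.

(* The axiom of the library structure [Complete], for the uniformity of
   [N]. *)
Definition banach_lattice : Prop :=
  forall F : set_system (normed_by N), ProperFilter F -> cauchy F -> cvg F.

End normed_by.

(* [sup] is [0] on unbounded sets, hence the separate boundedness clause. *)
Definition normalized_truncation (R : realType) (E : rieszType R)
    (T : truncation E) (N : lattice_norm E) : Prop :=
  let B := [set N (T x) | x in [set x : E | 0 <= x]] in
  has_ubound B /\ sup B = 1.

Definition unitization_norm (R : realType) (E : rieszType R)
    (T : truncation E) (N : lattice_norm E)
    (Nu : lattice_norm (unitization T)) : Prop :=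
  (forall x : E, Nu (uembed x) = N x) /\ Nu uone = 1.

(* Main.v *)
Require Import Defs.
From mathcomp Require Import all_boot all_order all_algebra.
From mathcomp Require Import all_classical all_reals all_analysis.
From mathcomp Require Import lra.

Set Implicit Arguments.
Unset Strict Implicit.
Unset Printing Implicit Defensive.

Import Order.TTheory GRing.Theory Num.Theory.
Import numFieldNormedType.Exports.

Local Open Scope classical_set_scope.
Local Open Scope ring_scope.

(** The unitization is the direct sum of [E] and the line spanned by [uone],
    so everything depends on whether the coordinate functional
    [ucoord : x + a |-> a] is bounded for the norm [Nu]; this amounts to [E],
    its kernel, being closed. Once [ucoord] is bounded, [Nu] is equivalent to
    the norm [N x + `|a|] of a direct sum ([unitization_norm_le],
    [le_unitization_norm]): Cauchy filters and their limits are computed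
    coordinatewise, and completeness passes from [E] to the sum
    ([banach_unitization]) and from the sum to the closed subspace [E]
    ([banach_of_unitization]).

    Either completeness hypothesis makes [ucoord] bounded. If it is not
    bounded, there are elements [u n] of coordinate [1] whose norms decay
    geometrically ([ucoord_bounded_seq]).
    - If [E] is complete, the [E]-parts [u n - 1] are Cauchy, with a limit [l]
      in [E]; then [l + 1] is the limit of [u n], namely [0], which is absurd
      ([ucoord_bounded_of_banach]).
    - If the sum is complete, use that [ucoord] is a lattice homomorphism onto
      the reals and that positive functionals on a Banach lattice are bounded:
      the series of the [rabs (u n)] converges to an element that dominates
      every partial sum, so its coordinate exceeds every natural number
      ([ucoord_bounded_of_banach_unitization]). *)

(** * Lattice norms and completeness *)

Lemma near_halfX_lt (R : realType) (e : R) : 0 < e ->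
  \forall n \near \oo, 2^-1 ^+ n < e.
Proof.
move=> e0; have h : geometric (1 : R) 2^-1 @ \oo --> (0 : R).
  by apply: cvg_geometric; rewrite ger0_norm ?invf_lt1 ?ltr1n.
apply: filterS (cvgr0_norm_lt _ h e e0) => n /=.
by rewrite mul1r ger0_norm ?exprn_ge0.
Qed.

Section lattice_norm_theory.
Context {R : realType} {E : rieszType R} (N : lattice_norm E).
Implicit Types x y z : E.

Lemma lnorm0 : N 0 = 0.
Proof. by rewrite -(scale0r 0) lnormZ normr0 mul0r. Qed.

Lemma lnormN x : N (- x) = N x.
Proof. by rewrite -scaleN1r lnormZ normrN1 mul1r. Qed.

Lemma lnorm_distC x y : N (x - y) = N (y - x).
Proof. by rewrite -lnormN opprB. Qed.

Lemma lnorm_distD y x z : N (x - z) <= N (x - y) + N (y - z).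
Proof. by apply: le_trans (lnormD _ _ _); rewrite addrA subrK. Qed.

Lemma lnorm_small_eq0 x : (forall e, 0 < e -> N x < e) -> x = 0.
Proof.
move=> xe; apply: (@lnorm0_eq0 _ _ N); apply/le_anti/andP; split.
  by apply/ler_addgt0Pr => e e0; rewrite add0r ltW ?xe.
exact: (normr_ge0 (x : normed_by N)).
Qed.

Lemma rabs_id x : 0 <= x -> rabs x = x.
Proof. by move=> x0; apply/join_idPl; rewrite (le_trans _ x0)// roppr_le0. Qed.

Lemma lnorm_abs x : N (rabs x) = N x.
Proof.
have rr := rabs_id (rabs_ge0 x).
by apply/le_anti/andP; split; apply: lnorm_abs_le; rewrite rr.
Qed.

(** Order intervals are norm closed: [rpos (w - l)] is dominated by
    [rabs (l - v)] for every [v] above [w], so its norm is arbitrarily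
    small. *)
Lemma lnorm_lim_ge w l :
  (forall e, 0 < e -> exists2 v, w <= v & N (l - v) < e) -> w <= l.
Proof.
move=> wl; suff p0 : rpos (w - l) = 0.
  by rewrite -rsubr_ge0 -opprB roppr_ge0 -p0 rpos_ge.
apply: lnorm_small_eq0 => e /wl[v wv]; apply: le_lt_trans.
apply: lnorm_abs_le; rewrite rabs_id ?rpos_ge0// leUx rabs_ge0 andbT.
by apply: (@le_trans _ _ (v - l)); rewrite ?rleD2r// -[v - l]opprB leUr.
Qed.

(** Speaks of completeness through [N] and the type [E] alone, so that filters
    can be moved between [E] and its unitization by plain images. *)
Lemma banach_latticeP : banach_lattice N <->
  forall F : set_system E, ProperFilter F ->
    (forall e, 0 < e -> exists x, F [set y | N (x - y) < e]) ->
    exists l, forall e, 0 < e -> F [set y | N (l - y) < e].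
Proof.
split=> cN F FF cF.
  have /cvg_ex[l Fl] : [cvg (F : set_system (normed_by N)) in normed_by N].
    apply: cN; apply: cauchy_exP => e /cF[x Fx]; exists x.
    by rewrite -ball_normE.
  exists l => e e0; have := Fl _ (nbhsx_ballx _ _ e0).
  by rewrite -ball_normE.
have [|l Fl] := cN F FF.
  move=> e e0; have [x] := (cauchyP F).1 cF e e0.
  by rewrite -ball_normE => Fx; exists x.
apply/cvg_ex; exists l => A; rewrite nbhs_ballP => -[e /= e0].
rewrite -ball_normE => eA; apply: filterS eA _; exact: Fl.
Qed.

Lemma banach_lattice_seq (u : nat -> E) : banach_lattice N ->
  (forall n, N (u n.+1 - u n) <= 2^-1 ^+ n) ->
  exists l, forall e, 0 < e ->
    \forall n \near \oo, N (l - u n) < e.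
Proof.
move=> /banach_latticeP cN uN; apply: (cN (u @ \oo)) => e e0.
(* The error bound telescopes: the tail of the geometric series from [n] to
   [n + k] is exactly the right-hand side. *)
have uD k n : N (u n - u (n + k)%N) <= 2 * 2^-1 ^+ n - 2 * 2^-1 ^+ (n + k).
  elim: k => [|k IHk]; first by rewrite addn0 !subrr lnorm0.
  apply: le_trans (lnorm_distD (u (n + k)%N) _ _) _.
  rewrite addnS [N (u (n + k)%N - _)]lnorm_distC.
  apply: le_trans (lerD IHk (uN _)) _.
  by rewrite exprS mulrA divff// mul1r; lra.
have [n _ /(_ n (leqnn n))/= ne] := near_halfX_lt (divr_gt0 e0 (ltr0Sn _ 1)).
exists (u n); exists n => // m /= nm.
rewrite -(subnKC nm); apply: le_lt_trans (uD _ _) _.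
have m0 : 0 <= 2^-1 ^+ m :> R by rewrite exprn_ge0.
by move: ne; rewrite subnKC//; lra.
Qed.

End lattice_norm_theory.

(** * Boundedness of the real coordinate *)

Section unitization_coord.
Context {R : realType} {E : rieszType R} (T : truncation E).
Local Notation U := (unitization T).
Implicit Types u v : U.

(** Annotated with codomain [R] since the second component of a pair lives in
    [R^o], whose module structure would otherwise interfere. *)
Definition ucoord u : R := u.2.

Lemma le_ucoord u v : u <= v -> ucoord u <= ucoord v.
Proof. by rewrite uleE => /uconeP[+ _]; rewrite /= subr_ge0. Qed.

Lemma ucoord_abs u : ucoord (rabs u) = `|ucoord u|.
Proof.
case: u => x a; have [->|a0] := eqVneq a 0; last by rewrite unitization_abs.
by rewrite -[(x, 0)]/(uembed x : U) uembed_abs /ucoord normr0.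
Qed.

Lemma unitizationE u : u = uembed u.1 + ucoord u *: (uone : U).
Proof.
case: u => x a; congr pair; rewrite /= ?scaler0 ?addr0//.
by rewrite add0r -[RHS]/(a * 1) mulr1.
Qed.

Definition ucoord_bounded (Nu : lattice_norm U) :=
  exists2 c : R, 0 < c & forall u, c * `|ucoord u| <= Nu u.

(** Rescaling a violation of the bound with constant [2^-1 ^+ n.+1] to
    coordinate [1] yields [u n]. The exponent [n.+1] makes the sum of two
    consecutive norms at most [2^-1 ^+ n], as [banach_lattice_seq] requires. *)
Lemma ucoord_bounded_seq (Nu : lattice_norm U) :
  (forall u : nat -> U,
     ~ forall n, ucoord (u n) = 1 /\ Nu (u n) <= 2^-1 ^+ n.+1) ->
  ucoord_bounded Nu.
Proof.
move=> nou; apply: contrapT => unb.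
suff /choice[u uP] : forall n, exists u : U,
    ucoord u = 1 /\ Nu u <= 2^-1 ^+ n.+1 by exact: (nou u).
move=> n; apply: contrapT => nu; apply: unb; exists (2^-1 ^+ n.+1) => [|u].
  by rewrite exprn_gt0.
have [->|u0] := eqVneq (ucoord u) 0.
  by rewrite normr0 mulr0; exact: (normr_ge0 (u : normed_by Nu)).
rewrite leNgt; apply/negP => uN; apply: nu; exists ((ucoord u)^-1 *: u).
split; first by rewrite -[LHS]/((ucoord u)^-1 * ucoord u) mulVf.
rewrite lnormZ normfV mulrC ler_pdivrMr ?normr_gt0//.
exact: ltW.
Qed.

Context (N : lattice_norm E) (Nu : lattice_norm U).
Hypothesis hNu : unitization_norm N Nu.

(** [E] is complete, hence closed in the unitization, so [- uone] cannot be a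
    limit of elements of [E]. *)
Lemma ucoord_bounded_of_banach : banach_lattice N -> ucoord_bounded Nu.
Proof.
move=> cN; apply: ucoord_bounded_seq => u uP.
have uE n : u n = uembed (u n).1 + uone.
  by rewrite {1}[u n]unitizationE (uP n).1 scale1r.
have dE m n : uembed ((u m).1 - (u n).1) = u m - u n :> U.
  congr pair; rewrite -[RHS]/(ucoord (u m) - ucoord (u n)).
  by rewrite !(uP _).1 subrr.
have [|l ll] := @banach_lattice_seq _ _ N (fun n => (u n).1) cN.
  move=> n; rewrite -hNu.1 dE.
  apply: le_trans (lnormD _ _ _) _; rewrite lnormN.
  apply: le_trans (lerD (uP n.+1).2 (uP n).2) _.
  have p0 : 0 <= 2^-1 ^+ n :> R by rewrite exprn_ge0.
  by rewrite !exprS; lra.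
have /(congr1 (@ucoord)) : uembed l + uone = 0 :> U.
  apply: (@lnorm_small_eq0 _ _ Nu) => e e0.
  have e2 : 0 < e / 2 by rewrite divr_gt0.
  have [n [nl np]] := filter_ex (filterI (ll _ e2) (near_halfX_lt e2)).
  have -> : uembed l + uone = uembed (l - (u n).1) + u n :> U.
    rewrite {2}uE addrA; congr (_ + _); congr pair; last by rewrite /= addr0.
    by rewrite /= subrK.
  apply: le_lt_trans (lnormD _ _ _) _; rewrite hNu.1.
  have := (uP n).2; have : 0 <= 2^-1 ^+ n :> R by rewrite exprn_ge0.
  by move: nl np; rewrite /= exprS; lra.
by rewrite /ucoord /= add0r => /eqP; rewrite oner_eq0.
Qed.

(** The classical automatic continuity of positive functionals: the partial
    sums of the [rabs (u n)] increase to a limit above all of them, and their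
    coordinates [n] are unbounded. *)
Lemma ucoord_bounded_of_banach_unitization :
  banach_lattice Nu -> ucoord_bounded Nu.
Proof.
move=> cNu; apply: ucoord_bounded_seq => u uP.
pose s n := \sum_(k < n) rabs (u k) : U.
have sS n : s n.+1 = s n + rabs (u n) by rewrite /s big_ord_recr.
have [|l sl] := banach_lattice_seq (u := s) cNu.
  move=> n; rewrite sS addrAC subrr add0r lnorm_abs (le_trans (uP n).2)//.
  by rewrite exprS ler_piMl ?exprn_ge0// invf_le1 ?ler1n.
have s_homo n k : s n <= s (n + k)%N.
  elim: k => [|k IHk]; first by rewrite addn0.
  by rewrite addnS sS (le_trans IHk)// -[leLHS]addr0 rleD2l rabs_ge0.
have s_le n : s n <= l.
  apply: (@lnorm_lim_ge _ _ Nu) => e /sl[m _ /(_ _ (leq_addl n m))/= ?].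
  by exists (s (n + m)%N).
have s_coord n : ucoord (s n) = n%:R.
  elim: n => [|n IHn]; first by rewrite /s big_ord0.
  rewrite sS -[LHS]/(ucoord (s n) + ucoord (rabs (u n))) IHn ucoord_abs.
  by rewrite (uP n).1 normr1 natr1.
have := le_ucoord (s_le (Num.bound `|ucoord l|)); rewrite s_coord.
by rewrite leNgt (le_lt_trans (ler_norm _))// archi_boundP.
Qed.

(** * Transport of completeness *)

Lemma unitization_norm_le u : Nu u <= N u.1 + `|ucoord u|.
Proof.
rewrite {1}[u]unitizationE (le_trans (lnormD _ _ _))//.
by rewrite hNu.1 lnormZ hNu.2 mulr1.
Qed.

Lemma le_unitization_norm u : N u.1 <= Nu u + `|ucoord u|.
Proof.
rewrite -hNu.1 -[uembed _](addrK (ucoord u *: (uone : U))) -unitizationE.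
by rewrite (le_trans (lnormD _ _ _))// lnormN lnormZ hNu.2 mulr1.
Qed.

Lemma banach_unitization :
  ucoord_bounded Nu -> banach_lattice N -> banach_lattice Nu.
Proof.
move=> [c c0 cP] /banach_latticeP cN; apply/banach_latticeP => F FF cF.
(* Boundedness of [ucoord] makes both projections Lipschitz: with constant
   [c^-1] on the real coordinate, and [1 + c^-1] on the [E]-part. *)
have [a Fa] : exists a : R, ucoord @ F --> a.
  apply/cvg_ex; apply: R_complete; apply: cauchy_exP => e e0.
  have [u Fu] := cF (c * e) (mulr_gt0 c0 e0).
  exists (ucoord u); apply: (filterS (F := F) _ Fu) => v /= uv.
  rewrite -ball_normE /= -(ltr_pM2l c0); apply: le_lt_trans uv.
  exact: cP (u - v).
have [|l Fl] := cN (fst @ F).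
  move=> e e0; pose d := e / (1 + c^-1).
  have c1 : 0 < 1 + c^-1 by rewrite addr_gt0 ?invr_gt0.
  have [u Fu] := cF d (divr_gt0 e0 c1).
  exists u.1; apply: (filterS (F := F) _ Fu) => v /= uv.
  apply: (le_lt_trans (le_unitization_norm (u - v))).
  have : `|ucoord (u - v)| <= c^-1 * Nu (u - v) by rewrite ler_pdivlMl.
  move: uv; rewrite ltr_pdivlMr// mulrDr mulr1 [_ * c^-1]mulrC.
  by move=> h1 h2; apply: le_lt_trans h1; rewrite lerD2l.
exists (l, a) => e e0.
have e2 : 0 < e / 2 by rewrite divr_gt0.
have Fle : F [set u | N (l - u.1) < e / 2] := Fl _ e2.
have Fae : F [set u | `|a - ucoord u| < e / 2].
  exact: (cvgr_dist_lt _ _ Fa).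
apply: (filterS (F := F)) (filterI Fle Fae) => u /= [h1 h2].
apply: (le_lt_trans (unitization_norm_le _)).
by rewrite [ltRHS]splitr; exact: (ltrD h1 h2).
Qed.

Lemma banach_of_unitization :
  ucoord_bounded Nu -> banach_lattice Nu -> banach_lattice N.
Proof.
move=> [c c0 cP] /banach_latticeP cNu; apply/banach_latticeP => F FF cF.
have eB x y : uembed (x - y) = uembed x - uembed y :> U.
  by congr pair; rewrite subrr.
have [|u Fu] := cNu ((@uembed R E T : E -> U) @ F).
  move=> e /cF[x Fx]; exists (uembed x).
  by apply: (filterS (F := F) _ Fx) => y /=; rewrite -eB hNu.1.
(* The kernel of the bounded functional [ucoord] is closed. *)
have u0 : ucoord u = 0.
  apply/eqP; rewrite -normr_le0; apply/ler_addgt0Pr => e e0; rewrite add0r.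
  have Fue : F [set x | Nu (u - uembed x) < c * e] := Fu _ (mulr_gt0 c0 e0).
  have [x /= ux] := filter_ex Fue.
  rewrite -(ler_pM2l c0) (le_trans _ (ltW ux))// (le_trans _ (cP _))//.
  by rewrite -[ucoord (u - uembed x)]/(ucoord u - 0) subr0.
exists u.1 => e /Fu; apply: (filterS (F := F)) => x /=.
by rewrite {1}[u]unitizationE u0 scale0r addr0 -eB hNu.1.
Qed.

End unitization_coord.

Theorem theorem4p2 (R : realType) (E : rieszType R) (T : truncation E)
    (N : lattice_norm E) (hN : normalized_truncation T N)
    (Nu : lattice_norm (unitization T)) (hNu : unitization_norm N Nu) :
  banach_lattice N <-> banach_lattice Nu.
Proof.
split=> c.
  exact: (banach_unitization hNu (ucoord_bounded_of_banach hNu c) c).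
exact: (banach_of_unitization hNu (ucoord_bounded_of_banach_unitization c) c).
Qed.
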